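(* Let $p\ge 0$ be an integer, let $G$ be a minimal forbidden interval subgraph for the class of $p$-improper interval graphs, and let $\alpha$ be a minimal representation of $G$. Let $H$ be an unconfined, non-exterior side component of $G$ (with respect to $\alpha$). Then $H$ consists of a clique that is of maximal order among all interior potential blocking sets of $G$ (with respect to $\alpha$).
   Context: All graphs are finite and simple. An interval graph is a graph $G=(V,E)$ having a representation $\alpha: v\mapsto I_v$ by intervals of the real line such that, for distinct $v,w$, $vw\in E$ if and only if $I_v\cap I_w\neq\emptyset$. $G$ is $p$-improper if it has a representation in which no interval properly contains more than $p$ other intervals. The impropriety $\mathrm{imp}(G)$ is the smallest $p$ such that $G$ is $p$-improper. A representation is minimal if the maximum number of intervals properly contained in a single interval equals $\mathrm{imp}(G)$. A minimal forbidden interval subgraph for the class of $p$-improper interval graphs is an interval graph that is not $p$-improper but all of whose proper (induced) subgraphs are $p$-improper. A basepoint of $G$ is a vertex $z$ such that in every representation $I_z$ properly contains the intervals of at least $\mathrm{imp}(G)$ other vertices; ''the basepoint'' denotes this vertex $z$. The local components of $G$ are the connected components of $G\setminus\{z\}$; the support of a local component is the union of the intervals of its vertices. Given a representation, order the local components $H_0,\dots,H_m$ by their supports from left to right; $H_0$ and $H_m$ are the side components. A potential side component is a local component that is a side component in some representation. A vertex contributes to the impropriety of $G$ in a representation if its interval is properly contained in $I_z$. A side component is exterior if it contains at least one vertex at distance at least $2$ from $z$ (such a vertex is called an exterior vertex), and non-exterior otherwise. A potential side component $H$ is unconfined if there is a representation of $G$ in which $H$ contains no vertex that contributes to the impropriety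 of $G$; it is confined if in every representation it contains at least one such vertex. Given a representation, a blocking set of $G$ is a set of vertices that are adjacent to the basepoint $z$, whose intervals are not properly contained in $I_z$, and that are not adjacent to any exterior vertex of $G$ (it need not be an entire local component). A potential blocking set is a set of vertices of $G$ that can be made into a blocking set by changing the representation of $G$. Given a representation, an interior potential blocking set is a potential blocking set contained in a potential side component that is not an actual side component of that representation. *)

(* Defs.v *)
(* MathComp / MathComp-Analysis. *)
From mathcomp Require Import all_boot all_order all_algebra.
From mathcomp Require Import boolp classical_sets reals normedtype.
Import Order.TTheory GRing.Theory Num.Theory.

Set Implicit Arguments.
Unset Strict Implicit.
Unset Printing Implicit Defensive.

Local Open Scope classical_set_scope.
Local Open Scope ring_scope.

Record sgraph := SGraph {
  vertex :> finType;
  edge : rel vertex;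
  edge_sym : symmetric edge;
  edge_irrefl : irreflexive edge }.

Section Induced.
Variables (G : sgraph) (S : {set G}).

Definition induced_edge : rel {v : G | v \in S} :=
  fun u w => edge (val u) (val w).

Lemma induced_edge_sym : symmetric induced_edge.
Proof. by move=> u w; rewrite /induced_edge edge_sym. Qed.

Lemma induced_edge_irrefl : irreflexive induced_edge.
Proof. by move=> u; rewrite /induced_edge edge_irrefl. Qed.

Definition induced : sgraph := SGraph induced_edge_sym induced_edge_irrefl.

End Induced.

Section Representations.
Variable R : realType.
Implicit Type G : sgraph.

(* Intervals are nonempty and otherwise arbitrary: endpoints may be included
   or not, and may be infinite. *)
Definition representation G (alpha : G -> set R) : Prop :=
  (forall v, is_interval (alpha v) /\ alpha v !=set0) /\
  (forall v w, v != w -> (edge v w <-> alpha v `&` alpha w !=set0)).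

Definition interval_graph G : Prop :=
  exists alpha : G -> set R, representation alpha.

(* Number of intervals properly contained in that of v; v itself is never
   counted, [`<`] being strict. *)
Definition weight G (alpha : G -> set R) (v : G) : nat :=
  #|[set w : G | `[< alpha w `<` alpha v >]]%SET|.

Definition p_improper (p : nat) G : Prop :=
  exists2 alpha : G -> set R,
    representation alpha & forall v, (weight alpha v <= p)%N.

(* The default value 0 is only taken on graphs that are not interval graphs. *)
Definition imp G : nat :=
  xget 0%N [set p : nat | p_improper p G /\
                          forall q : nat, p_improper q G -> (p <= q)%N].

Definition minimal_representation G (alpha : G -> set R) : Prop :=
  representation alpha /\ (\max_(v : G) weight alpha v)%N = imp G.

Definition minimal_forbidden (p : nat) G : Prop :=
  [/\ interval_graph G, ~ p_improper p G &
      forall S : {set G}, S \proper [set: G]%SET -> p_improper p (induced S)].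

Definition basepoint G (z : G) : Prop :=
  forall alpha : G -> set R, representation alpha ->
    (imp G <= weight alpha z)%N.

Definition minus_edge G (z : G) : rel G :=
  [rel u w | [&& u != z, w != z & edge u w]].

(* Vertex sets of the connected components of G \ z. *)
Definition local_components G (z : G) : {set {set G}} :=
  equivalence_partition (connect (minus_edge z)) [set~ z]%SET.

Definition support G (alpha : G -> set R) (H : {set G}) : set R :=
  \bigcup_(v in [set` H]) alpha v.

Definition left_of (A B : set R) : Prop :=
  forall x y, A x -> B y -> x < y.

(* H is the first or the last local component in the left-to-right order of
   the supports; a unique local component is both. *)
Definition side_component G (alpha : G -> set R) (z : G) (H : {set G}) : Prop :=
  H \in local_components z /\
  ((forall K, K \in local_components z -> K != H ->
      left_of (support alpha H) (support alpha K)) \/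
   (forall K, K \in local_components z -> K != H ->
      left_of (support alpha K) (support alpha H))).

Definition potential_side_component G (z : G) (H : {set G}) : Prop :=
  exists2 alpha : G -> set R, representation alpha & side_component alpha z H.

Definition contributes G (alpha : G -> set R) (z v : G) : Prop :=
  alpha v `<` alpha z.

(* Holds also when u and v lie in different connected components. *)
Definition dist_at_least G (n : nat) (u v : G) : Prop :=
  forall s : seq G, path (@edge G) u s -> last u s = v -> (n <= size s)%N.

Definition exterior_vertex G (z v : G) : Prop := dist_at_least 2 z v.

Definition exterior G (z : G) (H : {set G}) : Prop :=
  exists2 v, v \in H & exterior_vertex z v.

Definition unconfined G (z : G) (H : {set G}) : Prop :=
  potential_side_component z H /\
  exists2 alpha : G -> set R, representation alpha &
    forall v, v \in H -> ~ contributes alpha z v.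

Definition blocking_set G (alpha : G -> set R) (z : G) (B : {set G}) : Prop :=
  forall v, v \in B ->
    [/\ edge z v, ~ alpha v `<` alpha z &
        forall w, exterior_vertex z w -> ~~ edge v w].

Definition potential_blocking_set G (z : G) (B : {set G}) : Prop :=
  exists2 alpha : G -> set R, representation alpha & blocking_set alpha z B.

Definition interior_potential_blocking_set G (alpha : G -> set R) (z : G)
    (B : {set G}) : Prop :=
  potential_blocking_set z B /\
  exists K : {set G}, [/\ potential_side_component z K,
                          ~ side_component alpha z K & B \subset K].

End Representations.

Definition clique (G : sgraph) (H : {set G}) : Prop :=
  forall u v, u \in H -> v \in H -> u != v -> edge u v.

(* n is the largest order of a member of F. There may be no member at all, in
   which case the condition is void: if z is adjacent to every vertex of a path
   on five vertices and to one pendant vertex h, then z is the basepoint,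
   imp = 3, the graph is minimal forbidden for p = 2, {h} is an unconfined
   non-exterior side component, and both local components are always side
   components. *)
Definition maximal_order_among (T : finType) (F : {set T} -> Prop) (n : nat) :
    Prop :=
  (forall B, F B -> (#|B| <= n)%N) /\
  ((exists B, F B) -> exists2 B, F B & #|B| = n).

Arguments interval_graph : clear implicits.
Arguments p_improper : clear implicits.
Arguments imp : clear implicits.
Arguments minimal_forbidden : clear implicits.
Arguments basepoint R {G} z.
Arguments potential_side_component R {G} z H.
Arguments unconfined R {G} z H.
Arguments potential_blocking_set R {G} z B.

(* Main.v *)
(* Every local component C meets the neighborhood of z (otherwise a
   representation of G without C, drawn next to C, would have too small an
   impropriety). Hence at most one local component has an interval sticking out
   of I_z on the left and at most one on the right, no component does both when
   there is another one, and each of the two can be replaced, in its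
   representation, by any component drawn at that end in another
   representation, the replaced one being moved inside I_z. The number of
   intervals inside I_z never drops below imp G.
   - If an interior potential blocking set B had more than |H| vertices, the
     component K containing it could be drawn in the place of H, with more
     vertices sticking out.
   - Delete h in H and take a representation of G - h in which I_z contains at
     most p < imp G intervals. Drawing the whole clique H sticking out of I_z at
     the end where H - h or a free end is would give a representation of G that
     is too good, so a component K that is interior for alpha occupies an end;
     if fewer than |H| vertices of K stick out, drawing H there instead is again
     too good. *)
Require Import Defs.
From mathcomp Require Import all_boot all_order all_algebra.
From mathcomp Require Import boolp classical_sets reals normedtype.
From mathcomp Require Import zify lra.
Import Order.TTheory GRing.Theory Num.Theory.
Set Implicit Arguments.
Unset Strict Implicit.
Unset Printing Implicit Defensive.

(** * Local components as connected sets closed under adjacency away from the basepoint *)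

Section Components.
Variables (G : sgraph) (z : G).

Lemma edgeC (u v : G) : edge u v = edge v u.
Proof. exact: edge_sym. Qed.

Lemma edge_neq (u v : G) : edge u v -> u != v.
Proof. by apply: contraTneq => ->; rewrite edge_irrefl. Qed.

Lemma connect_minus_edge_sym : connect_sym (minus_edge z).
Proof. by apply: sym_connect_sym => u v; rewrite /minus_edge /= andbCA edgeC. Qed.

Definition component (v : G) : {set G} :=
  [set w in [set~ z] | connect (minus_edge z) v w]%SET.

Lemma mem_component v : v != z -> v \in component v.
Proof. by move=> vz; rewrite !inE vz connect0. Qed.

Lemma component_local v : v != z -> component v \in local_components z.
Proof. by move=> vz; apply/imsetP; exists v; rewrite // !inE. Qed.

Lemma local_componentE C v :
  C \in local_components z -> v \in C -> C = component v.
Proof.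
case/imsetP=> x _ ->; rewrite !inE => /andP[_ xv].
by apply/setP=> w; rewrite !inE (same_connect connect_minus_edge_sym xv).
Qed.

Lemma local_component_neq C v : C \in local_components z -> v \in C -> v != z.
Proof. by move=> hC hv; move: (hv); rewrite (local_componentE hC hv) !inE => /andP[]. Qed.

Lemma local_component_edge C u v : C \in local_components z ->
  u \in C -> v != z -> edge u v -> v \in C.
Proof.
move=> hC uC vz uv; rewrite (local_componentE hC uC) !inE vz /=.
by apply: connect1; rewrite /minus_edge /= (local_component_neq hC uC) vz.
Qed.

Lemma local_component_eq C D v : C \in local_components z ->
  D \in local_components z -> v \in C -> v \in D -> C = D.
Proof. by move=> hC hD /(local_componentE hC) -> /(local_componentE hD) ->. Qed.

Lemma local_component_ind C (P : G -> Prop) : C \in local_components z ->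
  (forall u v, u \in C -> v \in C -> edge u v -> P u -> P v) ->
  forall u v, u \in C -> v \in C -> P u -> P v.
Proof.
move=> hC step u v uC vC Pu.
have /connectP[s] : connect (minus_edge z) u v.
  by move: vC; rewrite (local_componentE hC uC) !inE => /andP[].
elim: s u uC Pu => [|w s IH] u uC Pu /=; first by move=> _ ->.
move=> /andP[/and3P[_ wz uw]] /IH; apply.
  exact: (local_component_edge hC uC).
by apply: (step u w) => //; apply: (local_component_edge hC uC).
Qed.

Lemma local_component_neq0 C :
  C \in local_components z -> exists v, v \in C.
Proof.
by case/imsetP=> x; rewrite !inE => xz ->; exists x; rewrite !inE xz connect0.
Qed.

End Components.

(** * Intervals sticking out of the base interval *)

Section LowHigh.
Local Open Scope ring_scope.
Variables (R : realType) (G : sgraph) (z : G).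
Implicit Types (S T C D : {set G}) (b : G -> set R) (u v w : G).

(** Represents the subgraph induced by [S] through a map on all of [G], so that no subtype appears;
    the values off [S] are free. *)
Definition partial_representation S b : Prop :=
  (forall v, v \in S -> is_interval (b v) /\ exists x, b v x) /\
  (forall v w, v \in S -> w \in S -> v != w ->
     (edge v w <-> exists x, b v x /\ b w x)).

(** Phrased with a point beyond the whole base interval instead of endpoints, so that open, closed
    and unbounded intervals are treated alike. *)
Definition sticks_left b v : Prop :=
  exists2 x, b v x & forall y, b z y -> x < y.

Definition sticks_right b v : Prop :=
  exists2 x, b v x & forall y, b z y -> y < x.

(** Containment need not be proper here; [inside_proper] recovers properness once a second local
    component meets [S]. *)
Definition inside b v : Prop := forall x, b v x -> b z x.

(** Reflection exchanges the two ends, so that facts proved at the left end carry over to the right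
    one. *)
Definition mirror b (v : G) : set R := fun x => b v (- x).

Lemma partial_representationS S T b :
  T \subset S -> partial_representation S b -> partial_representation T b.
Proof.
move=> /fintype.subsetP TS [h1 h2]; split=> [v /TS|v w /TS ? /TS]; [exact: h1|exact: h2].
Qed.

Lemma representation_partial b :
  representation b <-> partial_representation [set: G]%SET b.
Proof.
split=> [] [h1 h2]; split.
- by move=> v _; apply: h1.
- by move=> v w _ _; apply: h2.
- by move=> v; apply: h1; rewrite inE.
- by move=> v w vw; apply: h2; rewrite ?inE.
Qed.

Lemma mirror_partial S b :
  partial_representation S b -> partial_representation S (mirror b).
Proof.
case=> h1 h2; split=> [v vS|v w vS wS vw].
  have [hi [x hx]] := h1 _ vS; split; last by exists (- x); rewrite /mirror opprK.
  move=> a c ha hc y /andP[ay yc]; apply: (hi _ _ hc ha).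
  by rewrite !lerN2 ay yc.
rewrite (h2 _ _ vS wS vw).
by split=> [] [x hx]; exists (- x); rewrite /mirror ?opprK.
Qed.

Lemma mirror_representation b : representation b -> representation (mirror b).
Proof. by rewrite !representation_partial; apply: mirror_partial. Qed.

Lemma sticks_left_mirror b v : sticks_left (mirror b) v <-> sticks_right b v.
Proof.
split=> [] [x hx hy]; exists (- x); rewrite /mirror ?opprK // => y hz.
  by rewrite ltrNr; apply: hy; rewrite /mirror opprK.
by rewrite ltrNl; apply: hy.
Qed.

Lemma sticks_right_mirror b v : sticks_right (mirror b) v <-> sticks_left b v.
Proof.
split=> [] [x hx hy]; exists (- x); rewrite /mirror ?opprK // => y hz.
  by rewrite ltrNl; apply: hy; rewrite /mirror opprK.
by rewrite ltrNr; apply: hy.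
Qed.

Lemma inside_mirror b v : inside (mirror b) v <-> inside b v.
Proof.
split=> h x hx; last exact: h.
by have := h (- x); rewrite /mirror opprK; apply.
Qed.

Lemma proper_mirror b v w :
  (mirror b v `<` mirror b w)%classic <-> (b v `<` b w)%classic.
Proof.
rewrite /proper; split=> [] [h1 h2]; split.
- by move=> x hx; have := h1 (- x); rewrite /mirror opprK; apply.
- by move=> h; apply: h2 => x hx; apply: h.
- by move=> x hx; apply: h1.
- by move=> h; apply: h2 => x hx; have := h (- x); rewrite /mirror opprK; apply.
Qed.

Lemma weight_mirror b v : weight (mirror b) v = weight b v.
Proof.
rewrite /weight; apply: eq_card => w; rewrite !inE.
by apply/asboolP/asboolP; rewrite proper_mirror.
Qed.

Lemma left_of_mirror b C D :
  left_of (Defs.support (mirror b) C) (Defs.support (mirror b) D) <->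
  left_of (Defs.support b D) (Defs.support b C).
Proof.
split=> h x y [u uC hx] [v vD hy].
  rewrite -ltrN2; apply: h; [exists v|exists u] => //; rewrite /mirror opprK //.
by rewrite -ltrN2; apply: h; [exists v|exists u].
Qed.

Lemma left_of_mirrorW b C :
  (forall D, D \in local_components z -> D != C ->
    left_of (Defs.support b D) (Defs.support b C)) ->
  forall D, D \in local_components z -> D != C ->
    left_of (Defs.support (mirror b) C) (Defs.support (mirror b) D).
Proof. by move=> h D hD DC; apply/left_of_mirror; apply: h. Qed.

Section Partial.
Variables (S : {set G}) (b : G -> set R).
Hypotheses (zS : z \in S) (hb : partial_representation S b).

Lemma interval_cross u x y a :
  u \in S -> b u x -> b u y -> x <= a -> a <= y -> b u a.
Proof.
move=> uS hx hy xa ay; apply: ((hb.1 _ uS).1 x y) => //.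
by rewrite xa ay.
Qed.

(** A point neither before nor after the whole base interval lies between two of its points, hence
    in it. *)
Lemma sticks_or_inside v : sticks_left b v \/ sticks_right b v \/ inside b v.
Proof.
have [|nl] := pselect (sticks_left b v); first by left.
have [|nr] := pselect (sticks_right b v); first by right; left.
right; right=> x hx.
have [y hy yx] : exists2 y, b z y & y <= x.
  apply: contrapT => h; apply: nl; exists x => // y hy; rewrite ltNge.
  by apply/negP => yx; apply: h; exists y.
have [y' hy' xy] : exists2 y, b z y & x <= y.
  apply: contrapT => h; apply: nr; exists x => // y' hy'; rewrite ltNge.
  by apply/negP => xy; apply: h; exists y'.
exact: (interval_cross zS hy hy').
Qed.

Lemma inside_not_right v : inside b v -> ~ sticks_right b v.
Proof. by move=> h [x /h hx hy]; have := hy _ hx; rewrite ltxx. Qed.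

Lemma meet_edge u v x : u \in S -> v \in S -> u != v -> b u x -> b v x -> edge u v.
Proof. by move=> uS vS uv hu hv; apply/(hb.2 _ _ uS vS uv); exists x. Qed.

Lemma edge_meet u v : u \in S -> v \in S -> edge u v -> exists x, b u x /\ b v x.
Proof. by move=> uS vS uv; apply/(hb.2 _ _ uS vS (edge_neq uv)). Qed.

Lemma inside_edge v : v \in S -> v != z -> inside b v -> edge z v.
Proof.
move=> vS vz h; have [_ [x hx]] := hb.1 _ vS.
by apply: (@meet_edge _ _ x); rewrite 1?eq_sym //; apply: h.
Qed.

(** Each of the two intervals runs from its sticking point into the base interval, so the later of
    the two sticking points lies in both. *)
Lemma sticks_left_clique u v : u \in S -> v \in S -> u != v ->
  edge z u -> edge z v -> sticks_left b u -> sticks_left b v -> edge u v.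
Proof.
move=> uS vS uv zu zv [x hx xz] [y hy yz].
have [a [haz hau]] := edge_meet zS uS zu.
have [c [hcz hcv]] := edge_meet zS vS zv.
have [xy|/ltW yx] := leP x y.
  apply: (@meet_edge _ _ y) => //.
  exact: (interval_cross uS hx hau xy (ltW (yz _ haz))).
apply: (@meet_edge _ _ x) => //.
exact: (interval_cross vS hy hcv yx (ltW (xz _ hcz))).
Qed.

End Partial.

(* The first clause only asks that [C :&: S] is connected or empty, in the form
   of an induction principle; it is needed for G itself and for G minus a vertex. *)
Definition attached S : Prop :=
  forall C, C \in local_components z ->
    (forall P : G -> Prop,
      (forall u v, u \in C -> v \in C -> u \in S -> v \in S ->
         edge u v -> P u -> P v) ->
      forall u v, u \in C -> v \in C -> u \in S -> v \in S -> P u -> P v) /\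
    (forall v, v \in C -> v \in S -> exists u, [/\ u \in C, u \in S & edge z u]).

Section Attached.
Variables (S : {set G}) (b : G -> set R).
Hypotheses (zS : z \in S) (hb : partial_representation S b) (hS : attached S).

(** Connectedness: an interval avoiding [x] stays on one side of it, and passing to an adjacent
    interval cannot change the side. *)
Lemma same_side C u v x a c : C \in local_components z ->
  (forall w, w \in C -> w \in S -> ~ b w x) ->
  u \in C -> v \in C -> u \in S -> v \in S -> b u a -> b v c -> a < x -> c < x.
Proof.
move=> hC hx uC vC uS vS ha hc ax.
apply: ((hS hC).1 (fun w => forall c, b w c -> c < x) _ u v) => //.
  move=> s t sC tC sS tS st Ps e he; rewrite ltNge; apply/negP => xe.
  have [y [ys yt]] := edge_meet hb sS tS st.
  have yx := Ps _ ys.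
  by apply: (hx _ tC tS); apply: (interval_cross hb tS yt he (ltW yx)).
move=> e he; rewrite ltNge; apply/negP => xe.
by apply: (hx _ uC uS); apply: (interval_cross hb uS ha he (ltW ax)).
Qed.

Lemma no_common_point C D u v x : C \in local_components z ->
  D \in local_components z -> C != D -> u \in C -> v \in D ->
  u \in S -> v \in S -> b u x -> ~ b v x.
Proof.
move=> hC hD CD uC vD uS vS hu hv.
have uv : u != v.
  apply: contra CD => /eqP uv; apply/eqP.
  by apply: (local_component_eq hC hD uC); rewrite uv.
have := meet_edge hb uS vS uv hu hv.
move=> /(local_component_edge hC uC (local_component_neq hD vD)) vC.
by move/eqP: CD; apply; apply: (local_component_eq hC hD vC).
Qed.

(** A non-neighbour of [z] that sticks out on the left lies entirely before the base interval, so
    its neighbours in [C] stick out as well. If all of these were again non-neighbours of [z], this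
    would spread through [C] and reach a neighbour of [z]. *)
Lemma sticks_left_neighbor C v : C \in local_components z ->
  v \in C -> v \in S -> sticks_left b v ->
  exists u, [/\ u \in C, u \in S, edge z u & sticks_left b u].
Proof.
move=> hC vC vS lv; apply: contrapT => no.
have [u [uC uS zu]] := (hS hC).2 _ vC vS.
have [] : ~~ edge z u /\ sticks_left b u; last by rewrite zu.
have key w : w \in C -> w \in S -> sticks_left b w -> ~~ edge z w /\ sticks_left b w.
  by move=> wC wS lw; split=> //; apply/negP => zw; apply: no; exists w.
apply: ((hS hC).1 (fun w => ~~ edge z w /\ sticks_left b w) _ v u) => //; last exact: key.
move=> s t sC tC sS tS st [zs [x hx xz]]; apply: key => //.
have [y [ys yt]] := edge_meet hb sS tS st.
exists y => // a ha; rewrite ltNge; apply/negP => ay; move/negP: zs; apply.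
apply: (@meet_edge _ _ hb z s a) => //.
  by rewrite eq_sym (local_component_neq hC sC).
exact: (interval_cross hb sS hx ys (ltW (xz _ ha)) ay).
Qed.

(** Both components contain a neighbour of [z] that sticks out on the left, and these two vertices
    are equal or adjacent. *)
Lemma sticks_left_unique C D u v : C \in local_components z ->
  D \in local_components z -> u \in C -> v \in D -> u \in S -> v \in S ->
  sticks_left b u -> sticks_left b v -> C = D.
Proof.
move=> hC hD uC vD uS vS lu lv.
have [u' [u'C u'S zu' lu']] := sticks_left_neighbor hC uC uS lu.
have [v' [v'D v'S zv' lv']] := sticks_left_neighbor hD vD vS lv.
have [uv|uv] := eqVneq u' v'.
  by apply: (local_component_eq hC hD u'C); rewrite uv.
apply: (local_component_eq hC hD _ v'D).
apply: (local_component_edge hC u'C (local_component_neq hD v'D)).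
exact: (sticks_left_clique zS hb u'S v'S).
Qed.

(** A component sticking out on both sides would, being connected, cover the whole base interval,
    including a point where [D] meets it. *)
Lemma left_right_covers C D u v w : C \in local_components z ->
  D \in local_components z -> C != D -> u \in C -> v \in C -> w \in D ->
  u \in S -> v \in S -> w \in S -> sticks_left b u -> ~ sticks_right b v.
Proof.
move=> hC hD CD uC vC wD uS vS wS [x hx xz] [y hy yz].
have [d [dD dS zd]] := (hS hD).2 _ wD wS.
have [a [az ad]] := edge_meet hb zS dS zd.
have : y < a.
  apply: (same_side hC _ uC vC uS vS hx hy (xz _ az)) => s sC sS hs.
  by apply: (no_common_point hC hD CD sC dD sS dS hs).
by rewrite ltNge (ltW (yz _ az)).
Qed.

(** [D] meets the base interval in a point that the interval of [v] misses. *)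
Lemma inside_proper C D v w : C \in local_components z ->
  D \in local_components z -> C != D -> v \in C -> w \in D ->
  v \in S -> w \in S -> inside b v -> (b v `<` b z)%classic.
Proof.
move=> hC hD CD vC wD vS wS iv; split=> // zv.
have [d [dD dS zd]] := (hS hD).2 _ wD wS.
have [a [az ad]] := edge_meet hb zS dS zd.
exact: (no_common_point hC hD CD vC dD vS dS (zv _ az)).
Qed.

End Attached.

(** By uniqueness no vertex of [D] sticks out on the left, so every point of [D] comes after the
    sticking point [x] of [C]; since [C] avoids that point of [D], all of [C] lies before it. *)
Lemma sticks_left_first b C v : representation b -> attached [set: G]%SET ->
  C \in local_components z -> v \in C -> sticks_left b v ->
  forall D, D \in local_components z -> D != C ->
    left_of (Defs.support b C) (Defs.support b D).
Proof.
move=> /representation_partial hb hS hC vC [x hx xz] D hD DC.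
have T w : w \in [set: G]%SET by rewrite inE.
move=> a c [k kC ha] [d dD hc]; rewrite ltNge; apply/negP => ca.
have nd : ~ sticks_left b d.
  move=> ld; move/eqP: DC; apply.
  by apply: (sticks_left_unique (T z) hb hS hD hC dD vC) => //; exists x.
have [y yz yc] : exists2 y, b z y & y <= c.
  apply: contrapT => h; apply: nd; exists c => // y hy; rewrite ltNge.
  by apply/negP => yx; apply: h; exists y.
have : a < c.
  apply: (same_side hb hS hC _ vC kC (T v) (T k) hx ha).
    by move=> s sC sS hs; apply: (no_common_point hb hD hC DC dD sC (T d) (T s) hc).
  exact: lt_le_trans (xz _ yz) yc.
by rewrite ltNge ca.
Qed.

Lemma interior_inside b C v : representation b -> attached [set: G]%SET ->
  C \in local_components z -> ~ side_component b z C -> v \in C -> inside b v.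
Proof.
move=> hb hS hC nside vC.
have hp := (representation_partial b).1 hb.
have [l|[r|//]] := sticks_or_inside (finset.in_setT z) hp v; case: nside; split=> //.
  by left; apply: (sticks_left_first hb hS hC vC l).
right=> D hD DC; apply/left_of_mirror.
apply: (sticks_left_first (mirror_representation hb) hS hC vC) => //.
exact/sticks_left_mirror.
Qed.

End LowHigh.

(** * Compressing the line into disjoint blocks *)

Section Placement.
Local Open Scope ring_scope.
Variable R : realType.
Implicit Types (A B : set R) (x y : R).

(** An increasing bijection of the line onto the open interval (-1, 1), so that unbounded intervals
    also fit into a block. *)
Definition squash x : R := x / (1 + `|x|).

Lemma squash_gt x : -1 < squash x.
Proof.
rewrite /squash ltr_pdivlMr; last by rewrite ltr_pwDl.
by have := ler_norm (- x); rewrite normrN; lra.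
Qed.

Lemma squash_lt x : squash x < 1.
Proof.
rewrite /squash ltr_pdivrMr; last by rewrite ltr_pwDl.
by have := ler_norm x; lra.
Qed.

Lemma squash_le : {mono squash : x y / x <= y}.
Proof.
apply: le_mono => x y xy.
rewrite /squash ltr_pdivrMr ?ltr_pwDl // mulrAC ltr_pdivlMr ?ltr_pwDl //.
have [x0|x0] := ger0P x; have [y0|y0] := ger0P y; try lra.
by have := mulr_le0_ge0 (ltW x0) y0; lra.
Qed.

Lemma squash_surj y : -1 < y -> y < 1 -> exists x, squash x = y.
Proof.
move=> y1 y2; exists (y / (1 - `|y|)); rewrite /squash.
have ny : 0 < 1 - `|y| by rewrite subr_gt0 ltr_norml y1.
rewrite normrM normfV (gtr0_norm ny).
have -> : 1 + `|y| / (1 - `|y|) = (1 - `|y|)^-1.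
  by rewrite -[X in X + _](divff (lt0r_neq0 ny)) -mulrDl subrK div1r.
by rewrite invrK divfK // lt0r_neq0.
Qed.

(** The block of index [i] is the open interval of radius 1 around [2i], so distinct blocks are
    disjoint and ordered by index. *)
Definition place (i : nat) A : set R := fun y => exists2 x, A x & y = i.*2%:R + squash x.

Lemma place_gt i A y : place i A y -> i.*2%:R - 1 < y.
Proof. by case=> x _ ->; have := squash_gt x; lra. Qed.

Lemma place_lt i A y : place i A y -> y < i.*2%:R + 1.
Proof. by case=> x _ ->; have := squash_lt x; lra. Qed.

Lemma place_before i j A B x y : (i < j)%N -> place i A x -> place j B y -> x < y.
Proof.
move=> ij /place_lt hx /place_gt hy.
have : i.+1.*2%:R <= j.*2%:R :> R by rewrite ler_nat leq_double.
by rewrite doubleS -addn2 natrD; lra.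
Qed.

Lemma place_squash i A x : place i A (i.*2%:R + squash x) <-> A x.
Proof.
split=> [[x' hx' /addrI e]|hx]; last by exists x.
have [xx'|xx'|-> //] := ltgtP x x'; move: xx'; rewrite -(leW_mono squash_le) e ltxx //.
Qed.

(** Surjectivity of [squash] onto (-1, 1) provides preimages for the points in between. *)
Lemma place_interval i A : is_interval A -> is_interval (place i A).
Proof.
move=> hA _ _ [x hx ->] [y hy ->] t /andP[xt ty].
have [s es] : exists s, squash s = t - i.*2%:R.
  by apply: squash_surj; have := squash_gt x; have := squash_lt y; lra.
exists s; last by rewrite es; lra.
apply: (hA _ _ hx hy).
by rewrite -(squash_le x) -(squash_le s) es lerBrDl xt lerBlDl ty.
Qed.

Lemma place_meet i A B :
  (exists y, place i A y /\ place i B y) <-> exists x, A x /\ B x.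
Proof.
split=> [[y [[x hx ->]]]|[x [hA hB]]]; first by rewrite place_squash; exists x.
by exists (i.*2%:R + squash x); rewrite !place_squash.
Qed.

Lemma place_sub i A B :
  (forall y, place i A y -> place i B y) <-> (forall x, A x -> B x).
Proof.
split=> h x hx; last by case: hx => y /h hy ->; apply/place_squash.
by apply/(place_squash i)/h/place_squash.
Qed.

End Placement.

(** * Gluing three drawings along one long base interval *)

Section Glue.
Local Open Scope ring_scope.
Variables (R : realType) (G : sgraph) (z : G) (L N : {set G}).
Variables bL bM bN : G -> set R.
Hypotheses (zL : z \notin L) (zN : z \notin N) (LN : [disjoint L & N]).
Hypothesis closedL : forall u v, u \in L -> v != z -> edge u v -> v \in L.
Hypothesis closedN : forall u v, u \in N -> v != z -> edge u v -> v \in N.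
Hypothesis hL : partial_representation (z |: L)%SET bL.
Hypothesis hM : representation bM.
Hypothesis hN : partial_representation (z |: N)%SET bN.
Hypothesis leftL : forall v, v \in L -> ~ sticks_right z bL v.
Hypothesis rightN : forall v, v \in N -> ~ sticks_left z bN v.
Hypothesis middle : forall v, v != z -> v \notin L -> v \notin N -> edge z v.

Let part v : nat := if v \in L then 0%N else if v \in N then 2 else 1%N.
Let piece v := if v \in L then bL v else if v \in N then bN v else bM v.

(* L is drawn in the block at 0, N in the block at 4 and everything else in the
   block at 2; the base interval runs from where [bL z] starts in the first
   block to where [bN z] ends in the last one. *)
Definition glue v : set R :=
  if v == z then
    fun y => (exists2 a, place 0 (bL z) a & a <= y) /\
             (exists2 a, place 2 (bN z) a & y <= a)
  else place (part v) (piece v).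

Let zLz : z \in (z |: L)%SET. Proof. by rewrite !inE eqxx. Qed.
Let zNz : z \in (z |: N)%SET. Proof. by rewrite !inE eqxx. Qed.
Let LL v : v \in L -> v \in (z |: L)%SET. Proof. by rewrite !inE orbC => ->. Qed.
Let NN v : v \in N -> v \in (z |: N)%SET. Proof. by rewrite !inE orbC => ->. Qed.
Let neqL v : v \in L -> v != z.
Proof. by apply: contraTneq => ->. Qed.
Let neqN v : v \in N -> v != z.
Proof. by apply: contraTneq => ->. Qed.
Let notL v : v \in N -> v \in L = false.
Proof. by move=> vN; apply/negbTE/negP => /(disjointFr LN); rewrite vN. Qed.

Let glueL v : v \in L -> glue v = place 0 (bL v).
Proof. by move=> vL; rewrite /glue (negbTE (neqL vL)) /part /piece vL. Qed.
Let glueN v : v \in N -> glue v = place 2 (bN v).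
Proof. by move=> vN; rewrite /glue (negbTE (neqN vN)) /part /piece vN notL. Qed.

Let glue_base : glue z = fun y => (exists2 a, place 0 (bL z) a & a <= y) /\
             (exists2 a, place 2 (bN z) a & y <= a).
Proof. by rewrite /glue eqxx. Qed.

Let baseL : exists a, place 0 (bL z) a.
Proof. by have [_ [x hx]] := hL.1 _ zLz; eexists; exists x. Qed.

Let baseN : exists a, place 2 (bN z) a.
Proof. by have [_ [x hx]] := hN.1 _ zNz; eexists; exists x. Qed.

Let base_middle (B : set R) y : place 1 B y -> glue z y.
Proof.
move=> hy; have [a ha] := baseL; have [c hc] := baseN; rewrite glue_base.
by split; [exists a|exists c] => //; apply/ltW;
  [apply: place_before ha hy|apply: place_before hy hc].
Qed.

(** Prolonging the base interval to the right captures no new point of [v], because [v] does not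
    stick out on that side of [bL z]. *)
Let base_L v x : v \in L -> bL v x -> glue z (0.*2%:R + squash x) <-> bL z x.
Proof.
move=> vL hx; rewrite glue_base; split=> [[[_ [t ht ->] tx] _]|hz].
  have tx' : t <= x by rewrite -squash_le; lra.
  have [s hs xs] : exists2 s, bL z s & x <= s.
    apply: contrapT => h; apply: (leftL vL); exists x => // s hs.
    by rewrite ltNge; apply/negP => xs; apply: h; exists s.
  exact: (interval_cross hL zLz ht hs).
split; first by (exists (0.*2%:R + squash x) => //; exists x).
have [c hc] := baseN; exists c => //; apply/ltW.
have hp : place 0 (bL z) (0.*2%:R + squash x) by exists x.
exact: place_before hp hc.
Qed.

Let base_N v x : v \in N -> bN v x -> glue z (2.*2%:R + squash x) <-> bN z x.
Proof.
move=> vN hx; rewrite glue_base; split=> [[_ [_ [t ht ->] tx]]|hz].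
  have tx' : x <= t by rewrite -squash_le; lra.
  have [s hs xs] : exists2 s, bN z s & s <= x.
    apply: contrapT => h; apply: (rightN vN); exists x => // s hs.
    by rewrite ltNge; apply/negP => xs; apply: h; exists s.
  exact: (interval_cross hN zNz hs ht).
split; last by (exists (2.*2%:R + squash x) => //; exists x).
have [c hc] := baseL; exists c => //; apply/ltW.
have hp : place 2 (bN z) (2.*2%:R + squash x) by exists x.
exact: place_before hc hp.
Qed.

Let base_edge v : v != z -> (edge z v <-> exists x, glue z x /\ glue v x).
Proof.
move=> vz; have zv : z != v by rewrite eq_sym.
have [vL|vL] := boolP (v \in L).
  rewrite (hL.2 _ _ zLz (LL vL) zv) (glueL vL); split=> [[x [h1 h2]]|[y [h1 [x h2 e]]]].
    exists (0.*2%:R + squash x); split; first exact/(base_L vL h2).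
    by exists x.
  by exists x; split=> //; apply/(base_L vL h2); rewrite -e.
have [vN|vN] := boolP (v \in N).
  rewrite (hN.2 _ _ zNz (NN vN) zv) (glueN vN); split=> [[x [h1 h2]]|[y [h1 [x h2 e]]]].
    exists (2.*2%:R + squash x); split; first exact/(base_N vN h2).
    by exists x.
  by exists x; split=> //; apply/(base_N vN h2); rewrite -e.
split=> [_|_]; last exact: middle.
have [_ [x hx]] := hM.1 v.
exists (1.*2%:R + squash x).
have h : place 1 (bM v) (1.*2%:R + squash x) by exists x.
split; first exact: base_middle h.
by rewrite /glue (negbTE vz) /part /piece (negbTE vL) (negbTE vN).
Qed.

Let part_edge u v : u != z -> v != z -> part u != part v -> ~~ edge u v.
Proof.
move=> uz vz; apply: contra => uv; have vu : edge v u by rewrite edgeC.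
rewrite /part.
have [uL|uL] := boolP (u \in L); first by rewrite (closedL uL vz uv).
have [vL|vL] := boolP (v \in L); first by move: uL; rewrite (closedL vL uz vu).
have [uN|uN] := boolP (u \in N); first by rewrite (closedN uN vz uv).
by have [vN|//] := boolP (v \in N); move: uN; rewrite (closedN vN uz vu).
Qed.

Let piece_edge u v : u != z -> v != z -> u != v -> part u = part v ->
  (edge u v <-> exists x, piece u x /\ piece v x).
Proof.
move=> uz vz uv; rewrite /part /piece.
have [uL|uL] := boolP (u \in L); have [vL|vL] := boolP (v \in L).
- by move=> _; apply: hL.2; rewrite ?LL.
- by case: ifP.
- by case: ifP.
have [uN|uN] := boolP (u \in N); have [vN|vN] := boolP (v \in N) => // _.
  by apply: hN.2; rewrite ?NN.
exact: hM.2.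
Qed.

Lemma glue_representation : representation glue.
Proof.
split=> [v|u v uv].
  have [->|vz] := eqVneq v z.
    rewrite glue_base; split.
      move=> a c [[d hd da] _] [_ [e he ce]] y /andP[ay yc]; split.
        by exists d => //; apply: le_trans ay.
      by exists e => //; apply: le_trans ce.
    rewrite -glue_base; have [_ [x hx]] := hM.1 z.
    by exists (1.*2%:R + squash x); apply: (@base_middle (bM z)); exists x.
  rewrite /glue (negbTE vz).
  have [hi [x hx]] : is_interval (piece v) /\ exists x, piece v x.
    rewrite /piece; case: ifPn => [vL|_]; first exact: (hL.1 _ (LL vL)).
    case: ifPn => [vN|_]; [exact: (hN.1 _ (NN vN))|exact: hM.1].
  split; first exact: place_interval.
  by eexists; exists x.
change (edge u v <-> exists x, glue u x /\ glue v x).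
have [e|uz] := eqVneq u z; first by rewrite e; apply: base_edge; rewrite -e eq_sym.
have [e|vz] := eqVneq v z.
  rewrite e edgeC base_edge //.
  by split=> [] [x [h1 h2]]; exists x.
rewrite /glue (negbTE uz) (negbTE vz).
have [e|ne] := eqVneq (part u) (part v).
  by rewrite -e place_meet; apply: piece_edge.
split=> [uv'|[x [hx hy]]]; first by have := part_edge uz vz ne; rewrite uv'.
by move: ne; rewrite neq_ltn => /orP[] h;
  [have := place_before h hx hy|have := place_before h hy hx]; rewrite ltxx.
Qed.

(** Properness is automatic: the base interval also covers the block at 2, which [v] does not
    meet. *)
Lemma glue_properL v : v \in L -> (glue v `<` glue z)%classic <-> inside z bL v.
Proof.
move=> vL; split=> [[h _] x hx|h].
  by apply/(base_L vL hx)/h; rewrite (glueL vL); exists x.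
split=> [y|hz].
  by rewrite (glueL vL) => -[x hx ->]; apply/(base_L vL hx)/h.
have [_ [x hx]] := hM.1 z.
have hy : place 1 (bM z) (1.*2%:R + squash x) by exists x.
have := hz _ (base_middle hy); rewrite (glueL vL) => h0.
by have := place_before (isT : (0 < 1)%N) h0 hy; rewrite ltxx.
Qed.

Lemma glue_properN v : v \in N -> (glue v `<` glue z)%classic <-> inside z bN v.
Proof.
move=> vN; split=> [[h _] x hx|h].
  by apply/(base_N vN hx)/h; rewrite (glueN vN); exists x.
split=> [y|hz].
  by rewrite (glueN vN) => -[x hx ->]; apply/(base_N vN hx)/h.
have [_ [x hx]] := hM.1 z.
have hy : place 1 (bM z) (1.*2%:R + squash x) by exists x.
have := hz _ (base_middle hy); rewrite (glueN vN) => h0.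
by have := place_before (isT : (1 < 2)%N) hy h0; rewrite ltxx.
Qed.

Lemma glue_left u v x y : u \in L -> v \notin L -> v != z ->
  glue u x -> glue v y -> x < y.
Proof.
move=> uL vL vz; rewrite (glueL uL) /glue (negbTE vz) => hx.
apply: place_before hx; rewrite /part (negbTE vL).
by case: ifP.
Qed.

(** Vertices in the middle block all lie inside the base interval, so they are counted without
    exception; only [L] and [N] can have vertices that do not contribute. *)
Lemma glue_weight : (weight glue z <= #|~: (z |: (L :|: N))| +
    #|[set v in L | `[< inside z bL v >]]| +
    #|[set v in N | `[< inside z bN v >]]|)%N.
Proof.
rewrite /weight -addnA.
set A := (~: _)%SET; set B := [set v in L | _]%SET; set C := [set v in N | _]%SET.
apply: (@leq_trans #|A :|: (B :|: C)|%SET).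
  apply: subset_leq_card; apply/fintype.subsetP => v.
  rewrite finset.in_set => /asboolP hv; rewrite !inE.
  have vz : v != z by apply/negP => /eqP e; rewrite e in hv; exact: properxx hv.
  rewrite (negbTE vz) /=.
  have [vL|vL] /= := boolP (v \in L).
    by rewrite (_ : `[< inside z bL v >]) ?orbT //; apply/asboolP/glue_properL.
  have [vN|//] /= := boolP (v \in N).
  by rewrite (_ : `[< inside z bN v >]) //; apply/asboolP/glue_properN.
apply: (leq_trans (leq_card_setU _ _)); rewrite leq_add2l.
exact: leq_card_setU.
Qed.

End Glue.

(** * Impropriety of minimal forbidden graphs and of their proper subgraphs *)

Section Impropriety.
Variable R : realType.

Lemma p_improper_leq p q (G : sgraph) :
  (p <= q)%N -> p_improper R p G -> p_improper R q G.
Proof. by move=> pq [b hb wb]; exists b => // v; apply: leq_trans pq. Qed.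

(** The largest weight in any representation is a valid bound, so a least bound exists and [imp] is
    not the default value of [xget]; if it were at most [p], then [G] would be [p]-improper. *)
Lemma imp_gt p (G : sgraph) : minimal_forbidden R p G -> (p < imp R G)%N.
Proof.
case=> -[a ha] np _.
have ex : exists n, `[< p_improper R n G >].
  exists (\max_v weight a v)%N; apply/asboolP; exists a => // v.
  exact: (@leq_bigmax _ (fun v => weight a v)).
have [] := @xgetPex _ 0%N
    [set q | p_improper R q G /\ forall r, p_improper R r G -> (q <= r)%N]%classic.
  case: (ex_minnP ex) => n /asboolP hn mn; exists n; split=> // r hr.
  by apply: mn; apply/asboolP.
rewrite -/(imp R G) => hi _; rewrite ltnNge; apply/negP => le.
by apply: np; apply: p_improper_leq le hi.
Qed.

Lemma proper_subgraph_representation p (G : sgraph) (S : {set G}) z :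
  minimal_forbidden R p G -> S \proper [set: G]%SET -> z \in S ->
  exists2 b : G -> set R, partial_representation S b &
    (#|[set v in S | `[< (b v `<` b z)%classic >]]%SET| <= p)%N.
Proof.
move=> [_ _ hp] /hp [b [hb1 hb2] wb] zS.
(* The value off [S] is a dummy that [partial_representation] never inspects. *)
pose c v : set R := if insub v is Some u then b u else setT.
have cE v (vS : v \in S) : c v = b (Sub v vS).
  by rewrite /c insubT.
exists c.
  split=> [v vS|v w vS wS vw]; first by rewrite !cE; apply: hb1.
  by rewrite !cE; apply: (hb2 (Sub v vS) (Sub w wS)).
apply: leq_trans (wb (Sub z zS)); rewrite /weight.
set A := [set v in S | _]%SET; set B := [set w | _]%SET.
apply: (@leq_trans #|[set val w | w in B]%SET|); last exact: leq_imset_card.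
apply: subset_leq_card; apply/fintype.subsetP => v.
rewrite finset.in_set => /andP[vS /asboolP hv].
apply/imsetP; exists (Sub v vS : induced S) => //.
by rewrite finset.in_set; apply/asboolP; rewrite -!cE.
Qed.

End Impropriety.

(** Reduces inequalities between sums of cardinalities to comparisons of indicators at each single
    vertex. *)
Lemma card_sum_mem (T : finType) (A : {set T}) : #|A| = (\sum_(v : T) (v \in A))%N.
Proof. by rewrite -sum1_card big_mkcond; apply: eq_bigr => v _; case: (v \in A). Qed.

(** * Local components around the basepoint *)

Section Basepoint.
Variables (R : realType) (p : nat) (G : sgraph) (z : G).
Hypotheses (hG : minimal_forbidden R p G) (hz : basepoint R z).

Lemma local_component_neighbor C :
  C \in local_components z -> exists2 u, u \in C & edge z u.
Proof.
move=> hC; apply: contrapT => no.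
have zC : z \notin C by apply/negP => /(local_component_neq hC); rewrite eqxx.
have [v0 v0C] := local_component_neq0 hC.
have [| |g hg wg] := @proper_subgraph_representation R p G (~: C)%SET z hG.
- by rewrite properE finset.subsetT; apply/fintype.subsetPn; exists v0; rewrite !inE ?v0C.
- by rewrite inE.
have [[a [ha1 ha2]] _ _] := hG.
(* [C] gets a block of its own, disjoint from the one holding the base interval, so only the at most
   [p] contributors of [g] remain. *)
pose b v := if v \in C then place 1 (a v) else place 0 (g v).
have across u v : u \in C -> v \notin C -> ~~ edge u v.
  move=> uC vC; apply/negP => uv.
  have [e|vz] := eqVneq v z; first by apply: no; exists u; rewrite // -e edgeC.
  by move: vC; rewrite (local_component_edge hC uC vz uv).
have hb : representation b.
  split=> [v|u v uv]; rewrite /b.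
    case: ifPn => vC.
      by have [hi [x hx]] := ha1 v; split; [exact: place_interval|eexists; exists x].
    have [|hi [x hx]] := hg.1 v; first by rewrite inE.
    by split; [exact: place_interval|eexists; exists x].
  change (edge u v <-> exists x, (if u \in C then place 1 (a u) else place 0 (g u)) x /\
     (if v \in C then place 1 (a v) else place 0 (g v)) x).
  have [uC|uC] := boolP (u \in C); have [vC|vC] := boolP (v \in C).
  - by rewrite place_meet; apply: ha2.
  - rewrite (negbTE (across _ _ uC vC)); split=> // -[x [hx hy]].
    by have := place_before (isT : (0 < 1)%N) hy hx; rewrite ltxx.
  - rewrite edgeC (negbTE (across _ _ vC uC)); split=> // -[x [hx hy]].
    by have := place_before (isT : (0 < 1)%N) hx hy; rewrite ltxx.
  - by rewrite place_meet; apply: hg.2; rewrite ?inE.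
have := hz hb; rewrite leqNgt => /negP; apply; apply: leq_ltn_trans (imp_gt hG).
apply: leq_trans wg; apply: subset_leq_card; apply/fintype.subsetP => v.
rewrite !finset.in_set => /asboolP; rewrite /b (negbTE zC).
case: ifPn => vC [h1 h2] /=.
  have [_ [x hx]] := ha1 v.
  have hy : place 1 (a v) (1.*2%:R + squash x)%R by exists x.
  by have := place_before (isT : (0 < 1)%N) (h1 _ hy) hy; rewrite ltxx.
apply/asboolP; split; first exact/(place_sub 0).
by move=> h; apply: h2; apply/(place_sub 0).
Qed.

Lemma attached_setT : attached z [set: G]%SET.
Proof.
move=> C hC; split.
  move=> P hP u v uC vC _ _; apply: (local_component_ind hC) uC vC => s t sC tC.
  by apply: hP; rewrite ?inE.
move=> v _ _; have [u uC zu] := local_component_neighbor hC.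
by exists u; rewrite uC inE.
Qed.

Lemma non_exterior_neighbor C v : C \in local_components z -> ~ exterior z C ->
  v \in C -> edge z v.
Proof.
move=> hC next vC; apply: contrapT => nzv; apply: next; exists v => //.
(* Only walks of length 0 and 1 need an argument; longer ones satisfy the bound at once. *)
move=> [|x [|y s]] //=; first by move=> _ e; have := local_component_neq hC vC; rewrite e eqxx.
by move=> /andP[zx _] e; case: nzv; rewrite -e.
Qed.

(** If [C] were the only component, nothing would contribute and the base interval would have weight
    0, whereas [imp] exceeds [p] and is thus positive. *)
Lemma exists_other_component (b : G -> set R) C : representation b ->
  C \in local_components z -> (forall v, v \in C -> ~ contributes b z v) ->
  exists2 D, D \in local_components z & C != D.
Proof.
move=> hb hC nc; apply: contrapT => no.
have := hz hb; rewrite leqNgt => /negP; apply.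
apply: leq_ltn_trans (imp_gt hG); rewrite (_ : weight b z = 0%N) //.
apply/eqP; rewrite cards_eq0 -finset.subset0; apply/fintype.subsetP => v.
rewrite finset.in_set => /asboolP hv; exfalso.
have vz : v != z by apply/negP => /eqP e; rewrite e in hv; exact: properxx hv.
have [e|ne] := eqVneq C (component z v); last first.
  by apply: no; exists (component z v) => //; exact: component_local.
by apply: (nc v _ hv); rewrite e mem_component.
Qed.

(* In the given representation every interval of H sticks out of the base
   interval, all of them on the same side. *)
Lemma unconfined_clique H : unconfined R z H -> ~ exterior z H -> clique H.
Proof.
case=> -[_ _ [hH _]] [b hb nc] next.
have [D hD HD] := exists_other_component hb hH nc.
have hp := (representation_partial b).1 hb.
have T v : v \in [set: G]%SET by rewrite inE.
have [d dD] := local_component_neq0 hD.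
have nin v : v \in H -> ~ inside z b v.
  by move=> vH iv; apply: (nc v vH); exact: (inside_proper (T z) hp attached_setT hH hD HD vH dD).
have nb v : v \in H -> edge z v := non_exterior_neighbor hH next (v := v).
move=> u v uH vH uv.
have [lu|[ru|/nin //]] := sticks_or_inside (T z) hp u;
  have [lv|[rv|/nin //]] := sticks_or_inside (T z) hp v => //; try exact: nin.
- by apply: (sticks_left_clique (T z) hp) => //; apply: nb.
- by case: (left_right_covers (T z) hp attached_setT hH hD HD uH vH dD).
- by case: (left_right_covers (T z) hp attached_setT hH hD HD vH uH dD).
- apply: (sticks_left_clique (T z) (mirror_partial hp)) => //; try exact: nb.
    exact/sticks_left_mirror.
  exact/sticks_left_mirror.
Qed.

End Basepoint.

(** * Exchanging the component at the left end *)

Section Swap.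
Variables (R : realType) (p : nat) (G : sgraph) (z : G).
Hypotheses (hG : minimal_forbidden R p G) (hz : basepoint R z).
Implicit Types (a b c : G -> set R) (S C H K B : {set G}).

Definition inside_part C b : {set G} := [set v in C | `[< inside z b v >]]%SET.

Lemma mem_inside_part C b v :
  (v \in inside_part C b) = (v \in C) && `[< inside z b v >].
Proof. by rewrite finset.in_set. Qed.

(* Union of the local components with a vertex of S sticking out of the base
   interval on the right; there is at most one, but none of them is singled out. *)
Definition right_part S b : {set G} :=
  [set v in [set~ z] | [exists w in component z v, (w \in S) && `[< sticks_right z b w >]]]%SET.

Lemma right_partP S b C v : C \in local_components z -> v \in C ->
  reflect (exists w, [/\ w \in C, w \in S & sticks_right z b w]) (v \in right_part S b).
Proof.
move=> hC vC; rewrite finset.in_set !inE (local_component_neq hC vC) /=.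
rewrite -(local_componentE hC vC); apply: (iffP exists_inP) => -[w].
  by move=> wC /andP[wS /asboolP rw]; exists w.
by move=> [wC wS rw]; exists w; rewrite // wS; apply/asboolP.
Qed.

Lemma right_part_neq S b v : v \in right_part S b -> v != z.
Proof. by rewrite finset.in_set !inE => /andP[]. Qed.

Lemma right_part_closed S b u v :
  u \in right_part S b -> v != z -> edge u v -> v \in right_part S b.
Proof.
move=> uN vz uv; have uz := right_part_neq uN.
have hC := component_local uz; have uC := mem_component uz.
have vC := local_component_edge hC uC vz uv.
by move/(right_partP _ _ hC uC): uN => h; apply/(right_partP _ _ hC vC).
Qed.

Lemma right_part_disjoint S b C : C \in local_components z ->
  (forall v, v \in C -> v \in S -> ~ sticks_right z b v) ->
  [disjoint C & right_part S b].
Proof.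
move=> hC h; apply/pred0P => v /=; apply/negP => /andP[vC].
by case/(right_partP _ _ hC vC) => w [wC wS]; apply: h.
Qed.

Lemma not_right_part S b v : v \in S -> v != z -> v \notin right_part S b ->
  ~ sticks_right z b v.
Proof.
move=> vS vz /negP vN rv; apply: vN.
have vC := mem_component vz.
by apply/(right_partP _ _ (component_local vz) vC); exists v.
Qed.

Section RightPart.
Variables (S K : {set G}) (bK b a : G -> set R).
Hypotheses (zS : z \in S) (hK : K \in local_components z).
Hypothesis ha : representation a.
Hypothesis hbK : partial_representation (z |: K)%SET bK.
Hypothesis hb : partial_representation S b.
Hypothesis nK : forall v, v \in K -> ~ sticks_right z bK v.
Hypothesis NS : forall v, v \in right_part S b -> v \in S.
Hypothesis KN : [disjoint K & right_part S b].
Hypothesis lN : forall v, v \in right_part S b -> ~ sticks_left z b v.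
Hypothesis middle : forall v, v != z -> v \notin K -> v \notin right_part S b -> edge z v.

(** The basic redrawing: [K] goes to the left end as in [bK], what sticks out on the right in [b]
    stays there, and everything else is put inside the base interval as in [a]. *)
Lemma swap_left : exists2 g : G -> set R, representation g &
  [/\ (weight g z <= #|~: (z |: (K :|: right_part S b))| + #|inside_part K bK| +
        #|inside_part (right_part S b) b|)%N,
      forall v, v \in K -> (g v `<` g z)%classic <-> inside z bK v &
      side_component g z K].
Proof.
have zK : z \notin K by apply/negP => /(local_component_neq hK); rewrite eqxx.
have zN : z \notin right_part S b by apply/negP => /right_part_neq; rewrite eqxx.
have cK u v : u \in K -> v != z -> edge u v -> v \in K.
  exact: local_component_edge.
have cN := @right_part_closed S b.
have hN : partial_representation (z |: right_part S b)%SET b.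
  apply: partial_representationS hb; apply/fintype.subsetP => v.
  by rewrite finset.in_setU1 => /orP[/eqP -> //|]; apply: NS.
exists (glue z K (right_part S b) bK a b); first exact: glue_representation.
split; first exact: glue_weight.
  by move=> v vK; apply: (glue_properL zK hbK ha hN nK).
split=> //; left=> D hD DK x y [u uK hx] [v vD hy].
apply: (glue_left zK uK _ _ hx hy).
  apply/negP => vK; move/eqP: DK; apply.
  exact: (local_component_eq hD hK vD vK).
exact: (local_component_neq hD vD).
Qed.

End RightPart.

(** The basepoint property, applied to the redrawn graph, becomes a lower bound on a sum of
    cardinalities. *)
Lemma imp_swap_left S K (bK : G -> set R) b a : z \in S -> K \in local_components z ->
  representation a ->
  partial_representation (z |: K)%SET bK -> partial_representation S b ->
  (forall v, v \in K -> ~ sticks_right z bK v) ->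
  (forall v, v \in right_part S b -> v \in S) ->
  [disjoint K & right_part S b] ->
  (forall v, v \in right_part S b -> ~ sticks_left z b v) ->
  (forall v, v != z -> v \notin K -> v \notin right_part S b -> edge z v) ->
  (imp R G <= #|~: (z |: (K :|: right_part S b))| + #|inside_part K bK| +
        #|inside_part (right_part S b) b|)%N.
Proof.
move=> zS hK ha hbK hb nK NS KN lN mid.
have [g hg [wg _ _]] := swap_left zS hK ha hbK hb nK NS KN lN mid.
exact: leq_trans (hz hg) wg.
Qed.

(** All clique vertices are drawn as [-1, 0] and touch the base interval [0, 1] only at 0, so that
    none of them contributes. *)
Definition clique_left (v : G) : set R := fun x =>
  if v == z then (0 <= x <= 1)%R else (-1 <= x <= 0)%R.

Lemma clique_left_representation C : (forall v, v \in C -> edge z v) -> clique C ->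
  partial_representation (z |: C)%SET clique_left.
Proof.
move=> nC cC; split=> [v _|u v].
  split; last by exists 0%R; rewrite /clique_left; case: ifP => _; lra.
  by move=> x y; rewrite /clique_left; case: ifP => _ h1 h2 t ht; lra.
rewrite !finset.in_setU1 => hu hv uv.
have e : edge u v.
  case/orP: hu => [/eqP eu|uC]; case/orP: hv => [/eqP ev|vC].
  - by move: uv; rewrite eu ev eqxx.
  - by rewrite eu; apply: nC.
  - by rewrite ev edgeC; apply: nC.
  - exact: cC.
split=> // _; exists 0%R; rewrite /clique_left.
by split; case: ifP => _; lra.
Qed.

Lemma clique_left_not_right v : v != z -> ~ sticks_right z clique_left v.
Proof.
move=> vz [x]; rewrite /clique_left (negbTE vz) => hx /(_ 0%R).
by rewrite eqxx => h; have : (0 < x)%R; [apply: h; lra|lra].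
Qed.

Lemma clique_left_inside C : z \notin C -> inside_part C clique_left = finset.set0.
Proof.
move=> zC; apply/setP => v; rewrite !finset.in_set; apply/negP => /andP[vC /asboolP h].
have vz : v != z by apply: contraNneq zC => <-.
have : (0 <= (-1 : R) <= 1)%R; last by lra.
by have := h (-1)%R; rewrite /clique_left (negbTE vz) eqxx; apply; lra.
Qed.

Lemma imp_swap_clique S H b a : z \in S -> H \in local_components z -> clique H ->
  (forall v, v \in H -> edge z v) -> representation a -> partial_representation S b ->
  (forall v, v \in right_part S b -> v \in S) ->
  [disjoint H & right_part S b] ->
  (forall v, v \in right_part S b -> ~ sticks_left z b v) ->
  (forall v, v != z -> v \notin H -> v \notin right_part S b -> edge z v) ->
  (imp R G <= #|~: (z |: (H :|: right_part S b))| +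
        #|inside_part (right_part S b) b|)%N.
Proof.
move=> zS hH cH nH ha hb NS HN lN mid.
have zH : z \notin H by apply/negP => /(local_component_neq hH); rewrite eqxx.
have := imp_swap_left zS hH ha (clique_left_representation nH cH) hb _ NS HN lN mid.
rewrite clique_left_inside // cards0 addn0; apply=> v vH.
exact: clique_left_not_right (local_component_neq hH vH).
Qed.

Let T v : v \in [set: G]%SET. Proof. by rewrite inE. Qed.

(* Here [c] draws K at the left end and [a] draws it inside the base interval,
   with H at the left end. *)
Lemma swapped_sticking_leq a c H K B : representation a -> weight a z = imp R G ->
  representation c ->
  H \in local_components z -> K \in local_components z -> K != H ->
  (forall v, v \in H -> edge z v) -> (forall v, v \in H -> ~ sticks_right z a v) ->
  (forall v, v != z -> v \notin H -> ~ sticks_left z a v) ->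
  (forall v, v \in K -> inside z a v) ->
  (forall v, v \in K -> ~ sticks_right z c v) ->
  B \subset K -> (forall v, v \in B -> ~ inside z c v) -> (#|B| <= #|H|)%N.
Proof.
move=> ha wa hc hH hK KH nH rH lH inK rK BK nB.
have pa := (representation_partial a).1 ha.
have pc := partial_representationS (finset.subsetT (z |: K)) ((representation_partial c).1 hc).
have att := attached_setT hG hz.
set N := right_part [set: G] a.
have dK : [disjoint K & N].
  by apply: right_part_disjoint => // v vK _; apply: inside_not_right (inK v vK).
have dH : [disjoint H & N] by apply: right_part_disjoint => // v vH _; exact: rH.
have inM v : v != z -> v \notin H -> v \notin N -> inside z a v.
  move=> vz vH vN; have [l|[r|//]] := sticks_or_inside (T z) pa v.
    by case: (lH v vz vH l).
  by case: (not_right_part (T v) vz vN r).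
have mid v : v != z -> v \notin K -> v \notin N -> edge z v.
  move=> vz _ vN; have [vH|vH] := boolP (v \in H); first exact: nH.
  exact: (inside_edge (T z) pa (T v) vz (inM v vz vH vN)).
have lN v : v \in N -> ~ sticks_left z a v.
  move=> vN; apply: lH; first exact: right_part_neq vN.
  by apply/negP => vH; rewrite (disjointFr dH vH) in vN.
(* In this redrawing [K] takes the left end as in [c], the right end is kept from [a], and [H] moves
   inside. *)
have := imp_swap_left (T z) hK ha pc pa rK (fun v _ => T v) dK lN mid.
rewrite -/N -wa /weight; set W := [set w | _]%SET; set M := (~: _)%SET.
have other v : v != z -> exists2 D, D \in local_components z & component z v != D.
  move=> vz; have [e|] := eqVneq (component z v) K; last by exists K.
  by exists H => //; rewrite e.
have prop v : v != z -> inside z a v -> v \in W.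
  move=> vz iv; rewrite finset.in_set; apply/asboolP.
  have [D hD CD] := other v vz; have [d dD] := local_component_neq0 hD.
  exact: (inside_proper (T z) pa att (component_local vz) hD CD (mem_component vz) dD).
have zK : z \in K = false by apply/negP => /(local_component_neq hK); rewrite eqxx.
have zN : z \in N = false by apply/negP => /right_part_neq; rewrite eqxx.
(* Outside [H], every vertex counted on the left already contributes in [a]. *)
have cnt : (#|M| + #|K| + #|inside_part N a| <= #|W| + #|H|)%N.
  rewrite !card_sum_mem -!big_split /=; apply: leq_sum => v _.
  rewrite mem_inside_part finset.in_setC finset.in_setU1 finset.in_setU.
  have [->|vz] /= := eqVneq v z; first by rewrite zK zN.
  have [vK|vK] /= := boolP (v \in K).
    rewrite (disjointFr dK vK) /=.
    by rewrite (prop v vz (inK v vK)).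
  have [vN|vN] /= := boolP (v \in N).
    by case: asboolP => [iv|//]; rewrite (prop v vz iv).
  have [vH|vH] /= := boolP (v \in H); first by rewrite addn1.
  by rewrite (prop v vz (inM v vz vH vN)).
(* The swap gains at most [#|H|] contributors and loses at least [#|B|] in [K]; as their number
   cannot drop below [imp], the bound follows. *)
have cB : (#|B| + #|inside_part K c| <= #|K|)%N.
  rewrite !card_sum_mem -!big_split /=; apply: leq_sum => v _.
  rewrite mem_inside_part; have [vB|vB] := boolP (v \in B).
    rewrite (fintype.subsetP BK _ vB) /=.
    by case: asboolP => // /(nB v vB).
  by case: (v \in K) => //=; case: asboolP.
by move: cnt cB; clear; lia.
Qed.

End Swap.

(** * Representations of the graph with one vertex of [H] deleted *)

Section Deletion.
Variables (R : realType) (p : nat) (G : sgraph) (z : G).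
Hypotheses (hG : minimal_forbidden R p G) (hz : basepoint R z).
Variables (H : {set G}) (h : G).
Hypotheses (hH : H \in local_components z) (hh : h \in H).
Hypotheses (nH : forall v, v \in H -> edge z v) (cH : clique H).
Hypothesis third : forall C, exists D, [/\ D \in local_components z, D != H & D != C].

Let S : {set G} := [set~ h]%SET.

Let notin_mem v : v \notin H -> v \in S.
Proof. by move=> vH; rewrite !inE; apply: contraNneq vH => ->. Qed.

Let zH : z \notin H.
Proof. by apply/negP => /(local_component_neq hH); rewrite eqxx. Qed.

Let zS : z \in S. Proof. exact: notin_mem. Qed.

Let mem_other C v : C \in local_components z -> C != H -> v \in C -> v \notin H.
Proof.
by move=> hC CH vC; apply: contra CH => vH; rewrite (local_component_eq hC hH vC vH).
Qed.

(** A clique stays connected when a vertex is removed, and the other components lose nothing. *)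
Lemma attached_deletion : attached z S.
Proof.
move=> C hC; have [->|CH] := eqVneq C H; split.
- move=> P hP u v uH vH uS vS; have [->//|uv] := eqVneq u v.
  by apply: hP => //; apply: cH.
- by move=> v vH vS; exists v; rewrite vH vS nH.
- move=> P hP u v uC vC _ _; apply: (local_component_ind hC) uC vC => s t sC tC.
  by apply: hP => //; apply: notin_mem; apply: mem_other CH _.
move=> v vC _; have [u uC zu] := local_component_neighbor hG hz hC.
by exists u; split=> //; apply: notin_mem; apply: mem_other CH _.
Qed.

Definition deletion_contributors (g : G -> set R) : {set G} :=
  [set v in S | `[< (g v `<` g z)%classic >]]%SET.

Lemma deletion_contributors_mirror g :
  deletion_contributors (mirror g) = deletion_contributors g.
Proof.
apply/setP => v; rewrite !finset.in_set; congr andb.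
by apply/asboolP/asboolP; rewrite proper_mirror.
Qed.

Section Representation.
Variables (g a : G -> set R).
Hypotheses (hg : partial_representation S g) (ha : representation a).

Let N := right_part z S g.

(** A third component, different from [H] and from that of [v], survives the deletion intact and
    makes the containment proper. *)
Lemma deletion_inside v : v != z -> v \in S -> inside z g v ->
  v \in deletion_contributors g.
Proof.
move=> vz vS iv; rewrite finset.in_set vS; apply/asboolP.
have [D [hD DH DC]] := third (component z v).
have [d dD] := local_component_neq0 hD.
have dS := notin_mem (mem_other hD DH dD).
have CD : component z v != D by rewrite eq_sym.
exact: (inside_proper zS hg attached_deletion (component_local vz) hD CD (mem_component vz) dD).
Qed.

Lemma deletion_left_not_right C u v : C \in local_components z -> u \in C -> v \in C ->
  u \in S -> v \in S -> sticks_left z g u -> ~ sticks_right z g v.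
Proof.
move=> hC uC vC uS vS; have [D [hD DH DC]] := third C.
have [d dD] := local_component_neq0 hD.
have dS := notin_mem (mem_other hD DH dD).
have CD : C != D by rewrite eq_sym.
exact: (left_right_covers zS hg attached_deletion hC hD CD uC vC dD).
Qed.

Hypothesis rH : forall v, v \in H -> v \in S -> ~ sticks_right z g v.

Let HN : [disjoint H & N]. Proof. exact: right_part_disjoint. Qed.

Let NS v : v \in N -> v \in S.
Proof. by move=> vN; apply/notin_mem/negP => vH; rewrite (disjointFr HN vH) in vN. Qed.

Let zN : z \in N = false.
Proof. by apply/negP => /right_part_neq; rewrite eqxx. Qed.

(** Nothing outside [H] occupies the left end, so the whole clique [H] can be drawn there. This
    restores [h] without creating a contributor. *)
Lemma deletion_clique_left :
  (forall v, v != z -> v \notin H -> ~ sticks_left z g v) ->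
  (imp R G <= #|deletion_contributors g|)%N.
Proof.
move=> lg.
have inM v : v != z -> v \notin H -> v \notin N -> inside z g v.
  move=> vz vH vN; have [l|[r|//]] := sticks_or_inside zS hg v.
    by case: (lg v vz vH l).
  by case: (not_right_part (notin_mem vH) vz vN r).
apply: leq_trans (imp_swap_clique hz zS hH cH nH ha hg NS HN _ _) _.
- move=> v vN; apply: lg; first exact: right_part_neq vN.
  by apply/negP => vH; rewrite (disjointFr HN vH) in vN.
- move=> v vz vH vN.
  exact: (inside_edge zS hg (notin_mem vH) vz (inM v vz vH vN)).
rewrite -/N !card_sum_mem -!big_split /=; apply: leq_sum => v _.
rewrite mem_inside_part finset.in_setC finset.in_setU1 finset.in_setU.
have [->|vz] /= := eqVneq v z; first by rewrite zN.
have [vH|vH] /= := boolP (v \in H); first by rewrite (disjointFr HN vH).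
have [vN|vN] /= := boolP (v \in N).
  by case: asboolP => [iv|//]; rewrite deletion_inside // notin_mem.
by rewrite deletion_inside ?notin_mem //; apply: inM.
Qed.

(** Two redrawings of all of [G] are compared with [g]: one keeps [K] at the left end and moves [H]
    inside, which yields [c]; the other puts the clique [H] at the left end and moves [K] inside,
    which bounds [#|B|] from below. *)
Lemma deletion_blocking_set K u : K \in local_components z -> K != H ->
  (forall v, v \in K -> edge z v) ->
  (forall v, v \in H -> v \in S -> ~ sticks_left z g v) ->
  u \in K -> sticks_left z g u -> (#|deletion_contributors g| < imp R G)%N ->
  exists2 c : G -> set R, representation c & side_component c z K /\
    exists B : {set G}, [/\ B \subset K, (#|H| <= #|B|)%N &
      forall v, v \in B -> ~ (c v `<` c z)%classic].
Proof.
move=> hK KH nK lH uK lu small.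
have uS := notin_mem (mem_other hK KH uK).
have KS v : v \in K -> v \in S by move=> /(mem_other hK KH) /notin_mem.
have lg v : v != z -> v \in S -> v \notin K -> ~ sticks_left z g v.
  move=> vz vS vK lv; move/negP: vK; apply.
  by rewrite (sticks_left_unique zS hg attached_deletion hK (component_local vz) uK
    (mem_component vz) uS vS lu lv) mem_component.
have rK v : v \in K -> ~ sticks_right z g v.
  by move=> vK; apply: (deletion_left_not_right hK uK vK uS (KS v vK) lu).
have KN : [disjoint K & N] by apply: right_part_disjoint => // v vK _; apply: rK.
have lN v : v \in N -> ~ sticks_left z g v.
  move=> vN; apply: lg (NS vN) _; first exact: right_part_neq vN.
  by apply/negP => vK; rewrite (disjointFr KN vK) in vN.
have inM v : v != z -> v \in S -> v \notin K -> v \notin N -> inside z g v.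
  move=> vz vS vK vN; have [l|[r|//]] := sticks_or_inside zS hg v.
    by case: (lg v vz vS vK l).
  by case: (not_right_part vS vz vN r).
have mid v : v != z -> v \notin N -> edge z v.
  move=> vz vN; have [vK|vK] := boolP (v \in K); first exact: nK.
  have [vH|vH] := boolP (v \in H); first exact: nH.
  have vS := notin_mem vH.
  exact: (inside_edge zS hg vS vz (inM v vz vS vK vN)).
have hgK : partial_representation (z |: K)%SET g.
  apply: partial_representationS hg; apply/fintype.subsetP => v.
  by rewrite finset.in_setU1 => /orP[/eqP -> //|]; apply: KS.
have [c hc [_ pc sc]] := swap_left zS hK ha hgK hg rK NS KN lN (fun v vz _ => mid v vz).
exists c => //; split=> //.
(* The vertices of [K] that stick out in [g]; they do so in [c] too, where [K] is drawn as in
   [g]. *)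
pose B := K :\: inside_part z K g; exists B; split.
- exact: finset.subsetDl.
- rewrite leqNgt; apply/negP => BH; move: small; rewrite ltnNge => /negP; apply.
  have := imp_swap_clique hz zS hH cH nH ha hg NS HN lN (fun v vz _ => mid v vz).
  rewrite -/N; set M := (~: _)%SET => le.
  (* Going from [g] to the second redrawing adds the vertices of [B] and takes out those of
     [H :\ h], all of which contribute in [g]. Since [h] is missing from [g], the loss is
     [#|H| - 1], so [#|B| < #|H|] already gives a contradiction. *)
  have cnt : (#|M| + #|inside_part z N g| + #|H :\ h| <=
              #|deletion_contributors g| + #|B|)%N.
    rewrite !card_sum_mem -!big_split /=; apply: leq_sum => v _.
    rewrite /B finset.in_setD1 finset.in_setD !mem_inside_part.
    rewrite finset.in_setC finset.in_setU1 finset.in_setU.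
    have [->|vz] /= := eqVneq v z; first by rewrite zN (negbTE zH) andbF.
    have [vH|vH] /= := boolP (v \in H).
      rewrite (disjointFr HN vH) /=; have [->//|vh] := eqVneq v h.
      have vS : v \in S by rewrite !inE.
      have vK : v \notin K by apply: contraL vH; apply: mem_other.
      have vN : v \notin N by rewrite (disjointFr HN vH).
      by rewrite deletion_inside //; apply: inM.
    have vS := notin_mem vH; rewrite andbF.
    have [vK|vK] /= := boolP (v \in K).
      rewrite (disjointFr KN vK) /= andbT.
      by case: asboolP => [iv|_] /=; [rewrite deletion_inside|rewrite addn1].
    have [vN|vN] /= := boolP (v \in N).
      by case: asboolP => [iv|//]; rewrite deletion_inside.
    by rewrite deletion_inside //; apply: inM.
  have := cardsD1 h H; rewrite hh; move: le cnt BH; clear; lia.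
move=> v; rewrite finset.in_setD mem_inside_part => /andP[nv vK] cv.
by move/negP: nv; apply; rewrite vK; apply/asboolP/pc.
Qed.

End Representation.
End Deletion.

(** * Comparing [H] with the interior components *)

Section SideComponents.
Variables (R : realType) (p : nat) (G : sgraph) (z : G) (a : G -> set R).
Hypotheses (hG : minimal_forbidden R p G) (hz : basepoint R z).
Hypothesis ha : minimal_representation a.

Let T v : v \in [set: G]%SET. Proof. by rewrite inE. Qed.

Lemma minimal_weight : weight a z = imp R G.
Proof.
have [ra ma] := ha; apply/eqP; rewrite eqn_leq (hz ra) andbT -ma.
exact: (@leq_bigmax _ (fun v => weight a v)).
Qed.

Lemma left_of_asym (b : G -> set R) C D : representation b ->
  C \in local_components z -> D \in local_components z ->
  left_of (Defs.support b C) (Defs.support b D) ->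
  ~ left_of (Defs.support b D) (Defs.support b C).
Proof.
move=> [hb _] hC hD CD DC.
have [c cC] := local_component_neq0 hC; have [d dD] := local_component_neq0 hD.
have [_ [x hx]] := hb c; have [_ [y hy]] := hb d.
have xy : (x < y)%R by apply: CD; [exists c|exists d].
have yx : (y < x)%R by apply: DC; [exists d|exists c].
by have := lt_trans xy yx; rewrite ltxx.
Qed.

(** There are only two ends: two of the three components share one, and each would precede the
    other. *)
Lemma side_component_pigeonhole C D E : side_component a z C ->
  side_component a z D -> side_component a z E -> C != D -> D != E -> C != E -> False.
Proof.
have ra := ha.1.
move=> [hC sC] [hD sD] [hE sE] CD DE CE.
have irr X Y := @left_of_asym a X Y ra.
case: sC => sC; case: sD => sD; try case: sE => sE.
all: first [ by apply: (irr C D hC hD); [apply: sC|apply: sD]; rewrite // eq_sym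
           | by apply: (irr D C hD hC); [apply: sC|apply: sD]; rewrite // eq_sym
           | by apply: (irr C E hC hE); [apply: sC|apply: sE]; rewrite // eq_sym
           | by apply: (irr E C hE hC); [apply: sC|apply: sE]; rewrite // eq_sym
           | by apply: (irr D E hD hE); [apply: sD|apply: sE]; rewrite // eq_sym
           | by apply: (irr E D hE hD); [apply: sD|apply: sE]; rewrite // eq_sym ].
Qed.

(** By [sticks_left_first] and its mirror image, anything sticking out at the wrong end would force
    an order opposite to the given one. *)
Lemma first_component_sticking (b : G -> set R) H K : representation b ->
  H \in local_components z -> K \in local_components z -> K != H ->
  (forall D, D \in local_components z -> D != H ->
     left_of (Defs.support b H) (Defs.support b D)) ->
  (forall v, v \in H -> ~ sticks_right z b v) /\
  (forall v, v != z -> v \notin H -> ~ sticks_left z b v).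
Proof.
move=> hb hH hK KH first; have att := attached_setT hG hz; split.
  move=> v vH /sticks_left_mirror lv.
  have /left_of_mirror := sticks_left_first (mirror_representation hb) att hH vH lv hK KH.
  exact: left_of_asym hb hH hK (first _ hK KH).
move=> v vz vH lv; have vC := mem_component vz; have hC := component_local vz.
have CH : H != component z v by apply: contraNneq vH => ->.
apply: (left_of_asym hb hC hH (sticks_left_first hb att hC vC lv hH CH)).
by apply: first; rewrite // eq_sym.
Qed.

Variable H : {set G}.
Hypotheses (sH : side_component a z H) (nH : forall v, v \in H -> edge z v).

Let hH : H \in local_components z := sH.1.

Let interior_neq K : ~ side_component a z K -> K != H.
Proof. by move=> nK; apply/negP => /eqP e; apply: nK; rewrite e. Qed.

Lemma interior_blocking_leq B :
  interior_potential_blocking_set a z B -> (#|B| <= #|H|)%N.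
Proof.
move=> [[c hc bB] [K [[_ _ [hK _]] nK BK]]].
have KH := interior_neq nK; have ra := ha.1; have att := attached_setT hG hz.
have [->|[b bb]] := finset.set_0Vmem B; first by rewrite cards0.
have bK := fintype.subsetP BK _ bb.
have [d dH] := local_component_neq0 hH.
have pc := (representation_partial c).1 hc.
(* Blocking only denies proper containment; the presence of [H] upgrades this to not being contained
   at all. *)
have nB v : v \in B -> ~ inside z c v.
  move=> vB iv; have [_ np _] := bB v vB; apply: np.
  exact: (inside_proper (T z) pc att hK hH KH (fintype.subsetP BK _ vB) dH).
have inK v (vK : v \in K) := interior_inside ra att hK nK vK.
(* After a reflection if necessary, [H] is the first component. *)
have [a' [ra' wa' fa' inK']] : exists a' : G -> set R, [/\ representation a', weight a' z = imp R G,
    forall D, D \in local_components z -> D != H ->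
      left_of (Defs.support a' H) (Defs.support a' D)
    & forall v, v \in K -> inside z a' v].
  case: sH => _ [f|f]; first by exists a; split=> //; apply: minimal_weight.
  exists (mirror a); split.
  - exact: mirror_representation.
  - by rewrite weight_mirror minimal_weight.
  - exact: left_of_mirrorW.
  - by move=> v vK; apply/inside_mirror/inK.
(* Independently, a reflection of [c] lets the sticking vertex [b] of [K] stick out on the left;
   then nothing in [K] sticks out on the right. *)
have [c' [rc' rK nB']] : exists c' : G -> set R, [/\ representation c',
    forall v, v \in K -> ~ sticks_right z c' v & forall v, v \in B -> ~ inside z c' v].
  have cover u v := left_right_covers (T z) pc att hK hH KH (u := u) (v := v) (w := d).
  have [lb|[rb|/(nB b bb) //]] := sticks_or_inside (T z) pc b.
    by exists c; split=> // v vK; apply: (cover b).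
  exists (mirror c); split; first exact: mirror_representation.
    by move=> v vK /sticks_right_mirror lv; apply: (cover v b).
  by move=> v vB /inside_mirror; apply: nB.
have [rH lH] := first_component_sticking ra' hH hK KH fa'.
exact: (swapped_sticking_leq hG hz ra' wa' rc' hH hK KH nH rH lH inK' rK BK nB').
Qed.

(** If [H] and [K] were the only components, [K] would occupy the end opposite to [H] and would not
    be interior. *)
Lemma third_component K : K \in local_components z -> ~ side_component a z K ->
  forall C, exists D, [/\ D \in local_components z, D != H & D != C].
Proof.
move=> hK nK C; have KH := interior_neq nK.
have [e|KC] := eqVneq K C; last by exists K.
apply: contrapT => no; apply: nK; split=> //.
have only D : D \in local_components z -> D != K -> D = H.
  move=> hD DK; apply: contrapT => /eqP DH; apply: no.
  by exists D; rewrite -e.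
by case: sH => _ [f|f]; [right|left] => D hD DK; rewrite (only D hD DK); apply: f.
Qed.

(** Being interior in [a], [K] lies inside the base interval there, so all its vertices are
    neighbours of [z]. A neighbour of a vertex of [K] is [z] or again in [K], hence never
    exterior. *)
Lemma interior_blocking_of_representation K (B : {set G}) (c : G -> set R) :
  K \in local_components z ->
  ~ side_component a z K -> representation c -> side_component c z K ->
  B \subset K -> (forall v, v \in B -> ~ (c v `<` c z)%classic) ->
  interior_potential_blocking_set a z B.
Proof.
move=> hK nK hc sc BK nB.
have nbK v : v \in K -> edge z v.
  move=> vK; apply: (inside_edge (T z) ((representation_partial a).1 ha.1) (T v)).
    exact: local_component_neq hK vK.
  exact: (interior_inside ha.1 (attached_setT hG hz) hK nK vK).
split; last by exists K; split=> //; exists c.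
exists c => // v vB; have vK := fintype.subsetP BK _ vB.
split; [exact: nbK|exact: nB|move=> w ew; apply/negP => vw].
have [e|wz] := eqVneq w z; first by have := ew [::] isT (esym e).
have zw := nbK w (local_component_edge hK vK wz vw).
by have := ew [:: w]; rewrite /= zw => /(_ isT erefl).
Qed.

Hypothesis cH : clique H.

Lemma exists_interior_blocking K : K \in local_components z -> ~ side_component a z K ->
  exists2 B, interior_potential_blocking_set a z B & #|B| = #|H|.
Proof.
move=> hK nK; have third := third_component hK nK; have ra := ha.1.
have [h hh] := local_component_neq0 hH.
have zh : z \in [set~ h]%SET.
  by rewrite !inE eq_sym (local_component_neq hH hh).
have [||g0 hg0 wg0] := @proper_subgraph_representation R p G [set~ h]%SET z hG => //.
  by rewrite properE finset.subsetT; apply/fintype.subsetPn; exists h; rewrite !inE ?eqxx.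
have in_del v : v \notin H -> v \in [set~ h]%SET.
  by move=> vH; rewrite !inE; apply: contraNneq vH => ->.
have att := attached_deletion hG hz hH hh nH cH.
(* In such a drawing, adding [h] without a new contributor would contradict the basepoint
   property. *)
pose good (g : G -> set R) := partial_representation [set~ h]%SET g /\
  (#|deletion_contributors z h g| < imp R G)%N.
have good0 : good g0 by split=> //; apply: leq_ltn_trans wg0 (imp_gt hG).
have goodM g : good g -> good (mirror g).
  by case=> pg wg; split; [exact: mirror_partial|rewrite deletion_contributors_mirror].
pose free (g : G -> set R) := forall v, v \in H -> v \in [set~ h]%SET ->
  ~ sticks_left z g v /\ ~ sticks_right z g v.
have freeM g : free g -> free (mirror g).
  by move=> fg v vH vS; rewrite sticks_left_mirror sticks_right_mirror; case: (fg v vH vS).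
have cliq g : good g -> (forall v, v \in H -> v \in [set~ h]%SET -> ~ sticks_right z g v) ->
    ~ forall v, v != z -> v \notin H -> ~ sticks_left z g v.
  move=> [pg wg] rH lg; move: wg; rewrite ltnNge => /negP; apply.
  exact: (deletion_clique_left hG hz hH hh nH cH third pg ra rH lg).
(* If a vertex of [H] other than [h] stuck out on the left, uniqueness would keep the other
   components away from that end, and all of [H] could be drawn there. *)
have goodL g : good g ->
    ~ exists v, [/\ v \in H, v \in [set~ h]%SET & sticks_left z g v].
  move=> gg [v [vH vS lv]]; apply: (cliq g gg).
    by move=> w wH wS; apply: (deletion_left_not_right hG hz hH hh nH cH third gg.1 hH vH wH).
  move=> w wz wH lw; have wS := in_del w wH; move/negP: wH; apply.
  by rewrite (sticks_left_unique zh gg.1 att hH (component_local wz) vH (mem_component wz)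
    vS wS lv lw) mem_component.
have block g C u : good g -> free g -> C \in local_components z -> ~ side_component a z C ->
    u \in C -> sticks_left z g u ->
    exists2 B, interior_potential_blocking_set a z B & #|B| = #|H|.
  move=> [pg wg] fg hC nC uC lu.
  have nbC v : v \in C -> edge z v.
    move=> vC; apply: (inside_edge (T z) ((representation_partial a).1 ra) (T v)).
      exact: local_component_neq hC vC.
    exact: (interior_inside ra (attached_setT hG hz) hC nC vC).
  have [c hc [sc [B [BC HB nB]]]] := deletion_blocking_set hG hz hH hh nH cH third pg ra
    (fun v vH vS => (fg v vH vS).2) hC (interior_neq nC) nbC
    (fun v vH vS => (fg v vH vS).1) uC lu wg.
  have iB := interior_blocking_of_representation hC nC hc sc BC nB.
  by exists B => //; apply/eqP; rewrite eqn_leq HB interior_blocking_leq.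
have f0 : free g0.
  move=> v vH vS; split=> sv; first by apply: (goodL g0) => //; exists v.
  apply: (goodL (mirror g0)); first exact: goodM.
  by exists v; split=> //; apply/sticks_left_mirror.
apply: contrapT => no.
(* Without a set of the wanted order, whatever sticks out in [g0] belongs to a side component of
   [a]. *)
have side v : v != z -> sticks_left z g0 v \/ sticks_right z g0 v ->
    side_component a z (component z v).
  move=> vz sv; apply: contrapT => nC; apply: no.
  have hC := component_local vz; have vC := mem_component vz.
  case: sv => [lv|/sticks_left_mirror rv]; first exact: (block g0 _ v good0 f0 hC nC vC lv).
  exact: (block (mirror g0) _ v (goodM _ good0) (freeM _ f0) hC nC vC rv).
have compH v : v != z -> v \notin H -> component z v != H.
  by move=> vz; apply: contra => /eqP <-; rewrite mem_component.
(* Neither end of [g0] can be free, so some [v] sticks out on the left and some [w] on the right,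
   both outside [H]. Their components are distinct and together with [H] would be three side
   components of [a]. *)
apply: (cliq g0 good0) => [v vH vS|v vz vH lv]; first by case: (f0 v vH vS).
apply: (cliq (mirror g0) (goodM _ good0)) => [w wH wS|w wz wH /sticks_left_mirror rw].
  by case: (freeM _ f0 w wH wS).
have [e|ne] := eqVneq (component z v) (component z w).
  have wC : w \in component z v by rewrite e mem_component.
  exact: (deletion_left_not_right hG hz hH hh nH cH third hg0 (component_local vz)
    (mem_component vz) wC (in_del v vH) (in_del w wH) lv rw).
by apply: (side_component_pigeonhole (side v vz _) (side w wz _) sH ne);
  [left|right|exact: compH|exact: compH].
Qed.

End SideComponents.

Theorem theorem7 (R : realType) (p : nat) (G : sgraph)
    (hG : minimal_forbidden R p G)
    (z : G) (hz : basepoint R z)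
    (alpha : G -> set R) (halpha : minimal_representation alpha)
    (H : {set G}) (hside : side_component alpha z H)
    (hunconf : unconfined R z H) (hnonext : ~ exterior z H) :
  clique H /\
  maximal_order_among (interior_potential_blocking_set alpha z) #|H|.
Proof.
have nH v (vH : v \in H) := non_exterior_neighbor hside.1 hnonext vH.
have cH := unconfined_clique hG hz hunconf hnonext.
(* For the second half, the given interior potential blocking set, possibly empty, only supplies the
   interior component [K]. *)
split=> //; split=> [B|[_ [_ [K [[_ _ [hK _]] nK _]]]]].
  exact: (interior_blocking_leq hG hz halpha hside nH).
exact: (exists_interior_blocking hG hz halpha hside nH cH hK nK).
Qed.
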